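(* Let $\phi = \frac{1+\sqrt5}{2}$, $a(n) = \lfloor n\phi\rfloor$, and let $F_k$ denote the $k$-th Fibonacci number ($F_0=0$, $F_1 = F_2 = 1$, $F_{k+2} = F_{k+1}+F_k$). Let $r$ be an odd positive integer and let $m, n$ be positive integers. Then $\phi^r\{m\phi\} - \phi^{r-2}\{n\phi\} = 1$ if and only if $m = a(n) + n + F_r$.
   Context: $\{x\} = x - \lfloor x\rfloor$ denotes the fractional part. *)

(* Defs.v *)
From mathcomp Require Import all_boot all_order all_algebra.
From mathcomp Require Import reals.

Set Implicit Arguments.
Unset Strict Implicit.
Unset Printing Implicit Defensive.

Import Order.TTheory GRing.Theory Num.Theory.

Local Open Scope ring_scope.

Fixpoint fib (k : nat) : nat :=
  if k is k'.+1 then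
    if k' is k''.+1 then (fib k' + fib k'')%N else 1%N
  else 0%N.

Definition phi (R : realType) : R := (1 + Num.sqrt 5) / 2.

Definition frac_part (R : realType) (x : R) : R := x - (Num.floor x)%:~R.

Definition a (R : realType) (n : nat) : int := Num.floor (n%:R * phi R).

(* Main.v *)
Require Import Defs.
From mathcomp Require Import all_boot all_order all_algebra.
From mathcomp Require Import reals.
From mathcomp Require Import ring lra zify.

(** Write [e] for the fractional part of [n * phi].  Since [phi ^ 2 = phi + 1],
    [(a n + n) * phi = 2 * a n + n + e / phi ^ 2], and for odd [r],
    [fib r * phi = fib (r + 1) + 1 / phi ^ r].  Hence [m' = a n + n + fib r]
    satisfies [{m' phi} = e / phi ^ 2 + 1 / phi ^ r], the right-hand side being
    less than 1; this is the required equation for [m'].  Conversely the equation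
    determines [{m phi}], and [m] is recovered from it as [phi] is irrational. *)

Set Implicit Arguments.
Unset Strict Implicit.
Unset Printing Implicit Defensive.

Import Order.TTheory GRing.Theory Num.Theory.

Local Open Scope ring_scope.

Lemma phi_sqr (R : realType) : phi R ^+ 2 = phi R + 1.
Proof.
have h5 : Num.sqrt (5 : R) ^+ 2 = 5 by rewrite sqr_sqrtr.
have -> : phi R ^+ 2 = (1 + 2 * Num.sqrt 5 + Num.sqrt 5 ^+ 2) / 4.
  by rewrite /phi; field.
by rewrite h5 /phi; field.
Qed.

Lemma phi_gt1 (R : realType) : 1 < phi R.
Proof.
have h : 1 < Num.sqrt (5 : R) by rewrite -[ltLHS]sqrtr1 ltr_sqrt; lra.
by rewrite /phi; lra.
Qed.

Lemma phi_lt2 (R : realType) : phi R < 2.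
Proof. by have := phi_sqr R; have := phi_gt1 R; nra. Qed.

Lemma phi_neq0 (R : realType) : phi R != 0.
Proof. by rewrite gt_eqF // (lt_trans ltr01 (phi_gt1 R)). Qed.

(* Descent: if [p * phi = q] with [0 < p], then [(q - p) * phi = p] and
   [0 < q - p < p]. *)
Lemma phi_irrational_nat (R : realType) (p : nat) (q : int) :
  p%:R * phi R = q%:~R -> p = 0%N.
Proof.
elim/ltn_ind: p q => p IH q pq; apply/eqP/contraT; rewrite -lt0n => p_gt0.
have p_gt0R : 0 < p%:R :> R by rewrite ltr0n.
have pZ : (p%:Z)%:~R = p%:R :> R by [].
have lt_pq : p%:Z < q by rewrite -(ltr_int R) pZ -pq; have := phi_gt1 R; nra.
have lt_qp : q < p%:Z + p%:Z.
  by rewrite -(ltr_int R) rmorphD /= pZ -pq; have := phi_lt2 R; nra.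
have [s sE] : exists s : nat, q = p%:Z + s%:Z.
  by exists `|q - p%:Z|%N; rewrite gez0_abs; lia.
have sq : s%:R * phi R = p%:Z%:~R.
  have : q%:~R = p%:R + s%:R :> R by rewrite sE rmorphD.
  by rewrite -pq pZ => h; have := phi_sqr R; have := phi_neq0 R; nra.
have := IH s _ _ sq; lia.
Qed.

Lemma phi_irrational (R : realType) (p q : int) :
  p%:~R * phi R = q%:~R -> p = 0.
Proof.
case: p => p pq; first by rewrite (phi_irrational_nat pq).
have : p.+1%:R * phi R = (- q)%:~R by rewrite rmorphN /= -pq NegzE rmorphN mulNr opprK.
by move/phi_irrational_nat.
Qed.

Lemma frac_part_unique (R : realType) (x : R) (z : int) :
  0 <= x - z%:~R < 1 -> frac_part x = x - z%:~R.
Proof.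
move=> /andP[h0 h1]; rewrite /frac_part (@floor_def _ x z) //.
by rewrite rmorphD /=; apply/andP; split; lra.
Qed.

Lemma frac_part_ge0_lt1 (R : realType) (x : R) : 0 <= frac_part x < 1.
Proof.
have := floor_itv x; rewrite /frac_part rmorphD /= => /andP[h0 h1].
by apply/andP; split; lra.
Qed.

(** Equal fractional parts make [(x - y) * phi] an integer, so irrationality forces [x - y = 0]. *)
Lemma frac_part_phi_inj (R : realType) (x y : int) :
  frac_part (x%:~R * phi R) = frac_part (y%:~R * phi R) -> x = y.
Proof.
rewrite /frac_part; set p := Num.floor _; set q := Num.floor _ => h.
apply/eqP; rewrite -subr_eq0; apply/eqP/(@phi_irrational R _ (p - q)).
by rewrite !rmorphB /=; lra.
Qed.

(** With the conjugate root [psi = - 1 / phi], this is [fib r * phi - fib r.+1 = - psi ^ r], cleared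
    of denominators. In the induction, multiplying [fib r.+1 * phi - fib r.+2] by [phi] gives the
    previous difference with its sign flipped. *)
Lemma phi_pow_fib (R : realType) (r : nat) :
  phi R ^+ r * ((fib r)%:R * phi R - (fib r.+1)%:R) = - (-1) ^+ r.
Proof.
elim: r => [|r IH]; first by rewrite /= !expr0; ring.
rewrite [in RHS]exprS mulN1r -IH exprSr.
have -> : (fib r.+2)%:R = (fib r.+1)%:R + (fib r)%:R :> R by rewrite -natrD.
by have := phi_sqr R; move: (fib r.+1) (phi R ^+ r) => f X h2; ring: h2.
Qed.

Lemma fib_phi_odd (R : realType) (r : nat) : odd r ->
  (fib r)%:R * phi R = (fib r.+1)%:R + (phi R ^+ r)^-1.
Proof.
move=> r_odd; have := phi_pow_fib R r.
rewrite -signr_odd r_odd expr1 opprK => h.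
have nz := expf_neq0 r (phi_neq0 R).
by apply: (mulfI nz); rewrite mulrDr mulfV //; lra.
Qed.

Lemma frac_part_shift (R : realType) (r n : nat) : odd r ->
  frac_part ((a R n + n%:Z + (fib r)%:Z)%:~R * phi R) =
  frac_part (n%:R * phi R) / phi R ^+ 2 + (phi R ^+ r)^-1.
Proof.
move=> r_odd; have := frac_part_ge0_lt1 (n%:R * phi R).
set e := frac_part _ => /andP[e_ge0 e_lt1].
have p1 := phi_gt1 R; have p2 := phi_sqr R; have p0 := phi_neq0 R.
have eE : n%:R * phi R = (a R n)%:~R + e by rewrite /e /frac_part /a; ring.
have inv1 : (phi R)^-1 = phi R - 1.
  by apply: (mulfI p0); rewrite mulfV //; ring: p2.
have inv2 : (phi R ^+ 2)^-1 = 2 - phi R by rewrite -exprVn inv1; ring: p2.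
have invr_gt0 : 0 < (phi R ^+ r)^-1 by rewrite invr_gt0 exprn_gt0 //; lra.
(* Oddness excludes [r = 0], hence [1 / phi ^ r <= 1 / phi]. *)
have invr_le : (phi R ^+ r)^-1 <= phi R - 1.
  rewrite -inv1 lef_pV2 ?posrE ?exprn_gt0 //; try lra.
  by case: r r_odd {invr_gt0} => // r _; rewrite exprS ler_peMr ?exprn_ege1 //; lra.
(* The intended floor: [2 * a n + n] comes from [(a n + n) * phi], and [fib r.+1] from
   [fib r * phi]. *)
pose z := a R n + a R n + n%:Z + (fib r.+1)%:Z.
have zE : (a R n + n%:Z + (fib r)%:Z)%:~R * phi R - z%:~R =
    e / phi R ^+ 2 + (phi R ^+ r)^-1.
  rewrite inv2 /z !rmorphD /= !mulrDl.
  have -> : (fib r)%:Z%:~R * phi R = (fib r.+1)%:R + (phi R ^+ r)^-1.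
    exact: fib_phi_odd.
  have aE : (a R n)%:~R = n%:R * phi R - e by rewrite eE; ring.
  by rewrite aE; ring: p2.
have p_lt2 := phi_lt2 R.
(* As [e < 1], the remainder is strictly below [1 / phi ^ 2 + 1 / phi = (2 - phi) + (phi - 1) =
   1]. *)
by rewrite (@frac_part_unique _ _ z) zE // inv2; apply/andP; split; nra.
Qed.

Theorem theorem3p10 (R : realType) (r m n : nat) :
  odd r -> (0 < m)%N -> (0 < n)%N ->
  phi R ^+ r * frac_part (m%:R * phi R)
    - phi R ^ (r%:Z - 2%:Z) * frac_part (n%:R * phi R) = 1
  <-> m%:Z = a R n + n%:Z + (fib r)%:Z.
Proof.
move=> r_odd _ _.
have p0 := phi_neq0 R; have nz := expf_neq0 r p0.
have shift := frac_part_shift R n r_odd.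
(* The exponent [r - 2] is an integer, negative at [r = 1]; splitting it exposes the common factor
   [phi ^ r], which is then cancelled. *)
rewrite expfzDr // -[phi R ^ - _]/((phi R ^+ 2)^-1) -[phi R ^ r%:Z]/(phi R ^+ r).
split=> [eq1|mE].
- apply: (@frac_part_phi_inj R); rewrite shift.
  by apply: (mulfI nz); rewrite [RHS]mulrDr mulfV // -[m%:~R]/(m%:R : R); lra.
- by rewrite -[m%:R : R]/(m%:Z%:~R) mE shift [X in X - _]mulrDr mulfV //; ring.
Qed.
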